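(* Let $G=(V,E)$ be a simple graph with $n$ vertices and $m\ (\ge 4)$ edges. Then, for any positive integer $k$ with $k\ge m-1$ and any $k$-assignment $L$ of $G$, $$P(G,L)-P(G,k)\ \ge\ \left((k-m+1)k^{n-3}+\frac{(k-m+3)c}{3}k^{n-5}\right)\sum_{uv\in E}|L(u)\setminus L(v)|$$ for some real number $c$ with $c\ge \frac{(m-1)(m-3)}{8}$; and in particular, when $G$ is $K_3$-free, this holds for some real number $c$ with $c\ge \binom{m-2}{2}+2\sqrt m-3$.
   Context: Graphs are finite. $\mathbb N$ is the set of positive integers and $[k]=\{1,\dots,k\}$. For $k\in\mathbb N$, $P(G,k)$ is the number of proper $k$-colorings of $G$, i.e. maps $f:V\to[k]$ with $f(u)\ne f(v)$ for every edge $uv$. A $k$-assignment of $G$ is a map $L:V\to 2^{\mathbb N}$ with $|L(v)|=k$ for all $v\in V$. An $L$-coloring of $G$ is a map $f:V\to\mathbb N$ with $f(v)\in L(v)$ for each $v\in V$ and $f(u)\neq f(v)$ for each pair of adjacent vertices $u,v$. $P(G,L)$ is the number of $L$-colorings of $G$. For a $k$-assignment $L$, $|L(u)\setminus L(v)|=|L(v)\setminus L(u)|$, so the sum over edges is well defined. $K_3$-free means containing no triangle. Powers $k^{j}$ with negative $j$ are allowed (real numbers). *)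

(* Defs.v *)
From HB Require Import structures.
From mathcomp Require Import all_boot all_order all_algebra finmap.
From mathcomp Require Import reals.

Set Implicit Arguments.
Unset Strict Implicit.
Unset Printing Implicit Defensive.

Import Order.TTheory GRing.Theory Num.Theory.

Local Open Scope nat_scope.
Local Open Scope fset_scope.

(* A simple graph is a symmetric irreflexive relation [e] on a finite type. *)

(* Each edge uv is represented by exactly one of the pairs (u, v), (v, u): the
   one that is increasing in the canonical enumeration of the vertices. *)
Definition edges (V : finType) (e : rel V) : {set V * V} :=
  [set p | e p.1 p.2 && (enum_rank p.1 < enum_rank p.2)].

Definition triangle_free (V : finType) (e : rel V) : Prop :=
  forall u v w : V, ~ [/\ e u v, e v w & e u w].

Definition proper_coloring (V : finType) (e : rel V) (C : eqType)
    (f : V -> C) : bool :=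
  [forall u, forall v, e u v ==> (f u != f v)].

(* The k colors are the elements of 'I_k. *)
Definition num_colorings (V : finType) (e : rel V) (k : nat) : nat :=
  #|[set f : {ffun V -> 'I_k} | proper_coloring e f]|.

(* Colors are positive integers. *)
Definition is_assignment (V : finType) (k : nat) (L : V -> {fset nat}) : Prop :=
  forall v : V, #|` L v| = k /\ (forall x, x \in L v -> 0 < x).

Definition list_coloring (V : finType) (e : rel V) (L : V -> {fset nat})
    (f : V -> nat) : bool :=
  [forall v, f v \in L v] && proper_coloring e f.

(* An L-coloring takes its values in the union of all the lists, so counting
   the maps from V to that finite set loses none of the maps from V to nat. *)
Definition num_list_colorings (V : finType) (e : rel V)
    (L : V -> {fset nat}) : nat :=
  #|[set f : {ffun V -> (\bigcup_(v <- enum V) L v)%fset} |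
      list_coloring e L (fun v => fsval (f v))]|.

(* If all the lists have the same size, |L u \ L v| = |L v \ L u|, hence the
   orientation chosen in [edges] does not matter. *)
Definition sum_list_diff (V : finType) (e : rel V) (L : V -> {fset nat}) : nat :=
  \sum_(p in edges e) #|` L p.1 `\` L p.2|.

(* Main.v *)
(* Whitney's broken cycle theorem expands both counts over the sets [B] of edges
   that contain no broken cycle:
     P(G,L) - P(G,k) = sum_B (-1)^|B| (b_L(B) - k^(n-|B|)),
   where [b_L(B)] counts the maps choosing from the lists that are constant along
   [B].  For such a forest [B], the defect [k^(n-|B|) - b_L(B)] is at most
   [k^(n-|B|-1)] times the sum of the [alpha a = |L u \ L v|] over the edges
   [a = uv] of [B], and at least [k^(n-|B|-1)] times each of them, hence times
   their average.  Each even [B] containing an edge [e] is charged to the [|B| - 1]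
   odd sets [B \ g] with [g <> e], so [alpha e] gets the coefficient
     sum_(B odd, e in B) k^(n-|B|-2) / |B| * (k - ext B),
   [ext B] being the number of edges that extend [B] without creating a broken
   cycle, and [ext B <= m - |B|].  The terms with [|B| = 1, 3] give the bound with
   [c] the number [q] of sets of size 3 containing [e].
   In general, when [|B| = 2], at most one edge is a chord of [B] and the other
   edges form classes of at most 4 edges parallel in [G/B]; the least edge of a
   class extends [B].  So [4 ext B >= m - 3] and [8 q >= ext {e} (m - 3)], and when
   [ext {e} < m - 1] the loss is compensated by the term [B = {e}].
   Without triangles, the sets of size 3 lost are 4-cycles through [e] minus an
   edge; if there are [x] of them, and [e] has [a] and [b] further edges at its
   ends, then [x <= a b] and [1 + a + b + x <= m], so [x <= (sqrt m - 1)^2]. *)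

Require Import Defs.
From HB Require Import structures.
From mathcomp Require Import all_boot all_order all_algebra finmap.
From mathcomp Require Import reals.
From mathcomp Require Import zify ring lra.

Set Implicit Arguments.
Unset Strict Implicit.
Unset Printing Implicit Defensive.

Import Order.TTheory GRing.Theory Num.Theory.

Local Open Scope nat_scope.

Lemma set_ind (T : finType) (P : {set T} -> Prop) :
  P set0 -> (forall (A : {set T}) x, x \notin A -> P A -> P (x |: A)) -> forall A, P A.
Proof.
move=> P0 PU A; have [n] := ubnP #|A|; elim: n A => // n IH A ltAn.
have [->//|[x xA]] := set_0Vmem A.
rewrite -(setD1K xA); apply: PU; first by rewrite !inE eqxx.
by apply: IH; move: ltAn; rewrite (cardsD1 x) xA.
Qed.

(** * Components of an edge set, and forests *)

Section Connectivity.

Variable V : finType.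
Implicit Types (A B : {set V * V}) (g h : V * V) (x y z : V).

Definition adj A : rel V := [rel x y | ((x, y) \in A) || ((y, x) \in A)].
Definition con A : rel V := connect (adj A).

Lemma adj_sym A : symmetric (adj A).
Proof. by move=> x y; rewrite /adj /= orbC. Qed.

Lemma con_sym A : connect_sym (adj A).
Proof. exact: sym_connect_sym (@adj_sym A). Qed.

Lemma conC A x y : con A x y = con A y x.
Proof. exact: con_sym. Qed.

Lemma con0 A x : con A x x.
Proof. exact: connect0. Qed.

Lemma con_trans A x y z : con A x y -> con A y z -> con A x z.
Proof. exact: connect_trans. Qed.

Lemma con_edge A g : g \in A -> con A g.1 g.2.
Proof. by case: g => x y gA; apply: connect1; rewrite /adj /= gA. Qed.

Lemma con_sub A B x y : A \subset B -> con A x y -> con B x y.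
Proof.
move=> sAB; apply: connect_sub => u v uv; apply: connect1; rewrite /adj /=.
by case/orP: uv => /(subsetP sAB)->; rewrite ?orbT.
Qed.

Lemma con_const (C : eqType) (f : V -> C) A x y :
  (forall a, a \in A -> f a.1 = f a.2) -> con A x y -> f x = f y.
Proof.
move=> fA /connectP[p]; elim: p x => [x _ -> //|z p IH x /= /andP[xz zp] yE].
rewrite -(IH z zp yE).
by case/orP: xz => [/fA|/fA].
Qed.

(** A walk can be shortened until it crosses [h] at most once, in one direction or the other. *)
Lemma con_setU1 A h x y : con (h |: A) x y ->
  [\/ con A x y, con A x h.1 /\ con A h.2 y | con A x h.2 /\ con A h.1 y].
Proof.
move=> /connectP[p]; elim: p x => [x _ -> |z p IH x /= /andP[xz zp] yE].
  by apply: Or31; apply: con0.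
have [xzA|xzh] : con A x z \/ (x, z) = h \/ (z, x) = h.
- case/orP: xz; rewrite in_setU1 => /orP[/eqP->|xzA]; auto.
    by left; apply: connect1; rewrite /adj /= xzA.
  by left; apply: connect1; rewrite /adj /= xzA orbT.
- case: (IH z zp yE) => [zy|[z1 z2]|[z1 z2]].
  + by apply: Or31; apply: con_trans xzA zy.
  + by apply: Or32; split=> //; apply: con_trans xzA z1.
  + by apply: Or33; split=> //; apply: con_trans xzA z1.
- case: (IH z zp yE); case: xzh => <- /=.
  + by move=> zy; apply: Or32; split; rewrite ?con0.
  + by move=> zy; apply: Or33; split; rewrite ?con0.
  + by move=> [z1 z2]; apply: Or32; split; rewrite ?con0.
  + by move=> [z1 z2]; apply: Or31.
  + by move=> [z1 z2]; apply: Or31.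
  + by move=> [z1 z2]; apply: Or33; split; rewrite ?con0.
Qed.

Lemma root_con A x y : (fingraph.root (adj A) x == fingraph.root (adj A) y) = con A x y.
Proof. exact: root_connect (@con_sym A) x y. Qed.

Inductive forest : {set V * V} -> Prop :=
| forest0 : forest set0
| forestU1 A h : forest A -> ~~ con A h.1 h.2 -> forest (h |: A).

(** Since [h] merges two components, sending a root to its new root is a bijection from the old
    roots other than that of [h.1] onto the new ones. *)
Lemma card_roots_setU1 A h : ~~ con A h.1 h.2 ->
  #|fingraph.roots (adj A)| = #|fingraph.roots (adj (h |: A))|.+1.
Proof.
move=> hA.
have rA x : con A x (fingraph.root (adj A) x) by apply: connect_root.
have rh x : con (h |: A) x (fingraph.root (adj (h |: A)) x) by apply: connect_root.
have sAh x y : con A x y -> con (h |: A) x y by apply: con_sub; apply: subsetU1.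
have hh : con (h |: A) h.1 h.2 by apply: con_edge; rewrite in_setU1 eqxx.
rewrite (cardD1 (fingraph.root (adj A) h.1)) {1}/in_mem /= roots_root; last exact: con_sym.
rewrite add1n; congr _.+1.
pose D := [predD1 fingraph.roots (adj A) & fingraph.root (adj A) h.1].
rewrite -[LHS](@card_in_image _ _ (fingraph.root (adj (h |: A))) D); last first.
  move=> x y; rewrite !inE => /andP[xu /eqP xr] /andP[yu /eqP yr] /eqP.
  rewrite root_con => /con_setU1[xy|[xh _]|[_ hy]].
  - by rewrite -xr -yr; apply/eqP; rewrite root_con.
  - by move: xu; rewrite -xr root_con xh.
  - by move: yu; rewrite -yr root_con conC hy.
apply: eq_card => r; apply/imageP/idP => [[x _ ->]|].
  by apply: roots_root; apply: con_sym.
(* Surjectivity: the old root of [h.1] was discarded, so a new root lying in its component is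
   reached from the root of [h.2]. *)
move=> /eqP rr; case: (boolP (con A r h.1)) => ru.
- exists (fingraph.root (adj A) h.2).
    by rewrite !inE root_con conC hA; apply: roots_root; apply: con_sym.
  rewrite -{1}rr; apply/eqP; rewrite root_con.
  by apply: con_trans (sAh _ _ (rA _)); apply: con_trans hh; apply: sAh.
- exists (fingraph.root (adj A) r).
    by rewrite !inE root_con ru; apply: roots_root; apply: con_sym.
  by rewrite -{1}rr; apply/eqP; rewrite root_con; apply: sAh.
Qed.

Lemma forest_card_roots A : forest A -> #|fingraph.roots (adj A)| + #|A| = #|V|.
Proof.
elim=> [|B h _ IH hB].
  rewrite cards0 addn0; apply: eq_card => x; transitivity true => //; apply/eqP.
  have /connectP[[|y p] /=] := connect_root (adj set0) x; first by move=> _ ->.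
  by rewrite /adj /= !inE.
have hnB : h \notin B by apply: contra hB; apply: con_edge.
by rewrite cardsU1 hnB addnA addn1 -card_roots_setU1.
Qed.

End Connectivity.

(** * Maps from lists that are constant along an edge set *)

Section Lists.

Variables (V U : finType) (L : V -> {set U}).
Implicit Types (A B : {set V * V}) (g h : V * V) (x y z : V).

Definition list_maps : {set {ffun V -> U}} :=
  [set f : {ffun V -> U} | [forall v, f v \in L v]].
Definition mono_maps A : {set {ffun V -> U}} :=
  [set f in list_maps | [forall a in A, f a.1 == f a.2]].
(** The choices for the single color that a map constant along [A] gives to the component of [x]. *)
Definition common A x : {set U} :=
  [set c | [forall y, con A x y ==> (c \in L y)]].
Definition alpha (a : V * V) : nat := #|L a.1 :\: L a.2|.

Lemma in_mono_maps A (f : {ffun V -> U}) : (f \in mono_maps A) =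
  (f \in list_maps) && [forall a in A, f a.1 == f a.2].
Proof. exact: in_set. Qed.

(** A map constant along [A] amounts to one common color per component, recorded at its root; [c0]
    only fills the values off the roots. *)
Lemma card_mono_maps (c0 : U) A :
  #|mono_maps A| = \prod_(r in fingraph.roots (adj A)) #|common A r|.
Proof.
pose rt := fingraph.root (adj A).
have rtP x : con A x (rt x) by apply: connect_root.
have rt_roots x : rt x \in fingraph.roots (adj A).
  by apply: roots_root; apply: con_sym.
pose F r := [pred c in common A r].
pose phi (f : {ffun V -> U}) : {ffun V -> U} :=
  [ffun x => if x \in fingraph.roots (adj A) then f x else c0].
have mono_con (f : {ffun V -> U}) : f \in mono_maps A ->
    forall x y, con A x y -> f x = f y.
  rewrite inE => /andP[_ /forall_inP fA] x y.
  by apply: con_const => a /fA/eqP.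
have -> : \prod_(r in fingraph.roots (adj A)) #|common A r|
    = #|pfamily c0 (fingraph.roots (adj A)) F|.
  by rewrite card_pfamily foldrE big_map big_enum; apply: eq_bigr.
rewrite -(@card_in_imset _ _ phi (mono_maps A)) => [|f g /mono_con fA /mono_con gA fg].
  apply: eq_card => g; apply/imsetP/pfamilyP => [[f fA ->]|[g0 gF]].
    split=> [|x xr].
      apply/supportP => x xr; rewrite ffunE.
      by case: ifP => // xr'; rewrite xr' in xr.
    rewrite !inE ffunE xr; apply/forallP => y; apply/implyP => xy.
    rewrite (mono_con f fA x y xy); move: fA; rewrite !inE => /andP[/forallP fL _].
    exact: fL.
  exists [ffun x => g (rt x)].
    rewrite !inE; apply/andP; split.
      apply/forallP => x; rewrite ffunE; have := gF _ (rt_roots x).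
      by rewrite !inE => /forallP/(_ x)/implyP; apply; rewrite conC.
    apply/forall_inP => a /con_edge aA; rewrite !ffunE.
    by have /eqP-> : rt a.1 == rt a.2 by rewrite /rt root_con.
  apply/ffunP => x; rewrite !ffunE; case: ifP => [/eqP xr|xr]; first by rewrite /rt xr.
  by apply: (supportP g0); rewrite xr.
apply/ffunP => x; rewrite (fA _ _ (rtP x)) (gA _ _ (rtP x)).
by move/ffunP: fg => /(_ (rt x)); rewrite !ffunE rt_roots.
Qed.

Variables (k : nat) (L_k : forall v, #|L v| = k).

(** Each edge of the component costs at most [alpha] colors. Edges are added one at a time; when [h]
    merges two components, the union of their common sets has at most [k + alpha h] colors, which
    bounds the intersection from below. *)
Lemma common_ge A x : k <= #|common A x| + \sum_(a in A | con A x a.1) alpha a.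
Proof.
elim/set_ind: A x => [|A h hA IH] x.
  rewrite big1 ?addn0 => [|a]; last by rewrite inE.
  rewrite -(L_k x); apply: subset_leq_card; apply/subsetP => c cx.
  rewrite inE; apply/forallP => y; apply/implyP => xy.
  suff <- : x = y by [].
  by apply: (con_const _ xy) => a; rewrite inE.
have sAh u v : con A u v -> con (h |: A) u v by apply: con_sub; apply: subsetU1.
have hh : con (h |: A) h.1 h.2 by apply: con_edge; rewrite in_setU1 eqxx.
(* If [h] is outside the component of [x], that component does not change. *)
case: (boolP (con (h |: A) x h.1)) => xh; last first.
  have xE y : con (h |: A) x y = con A x y.
    apply/idP/idP => [/con_setU1[//|[xh1 _]|[xh2 _]]|/sAh//].
      by rewrite (sAh _ _ xh1) in xh.
    by rewrite (con_trans (sAh _ _ xh2)) // conC in xh.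
  have -> : common (h |: A) x = common A x.
    apply/setP => c; rewrite !inE; apply: eq_forallb => y; by rewrite xE.
  apply: leq_trans (IH x) _; rewrite leq_add2l.
  rewrite [leqRHS]big_mkcond [leqLHS]big_mkcond /=; apply: leq_sum => a _.
  by rewrite xE in_setU1; case: (a \in A); rewrite ?orbT.
have sumE : \sum_(a in h |: A | con (h |: A) x a.1) alpha a =
    alpha h + \sum_(a in A | con (h |: A) x a.1) alpha a.
  rewrite (bigD1 h) /= ?in_setU1 ?eqxx //; congr addn; apply: eq_bigl => a.
  rewrite in_setU1; case: (altP (a =P h)) => [->|]; last by rewrite andbT.
  by rewrite andbF (negPf hA).
(* If [h] closes a cycle, the components stay the same and the sum can only grow. *)
case: (boolP (con A h.1 h.2)) => h12.
  have hE u v : con (h |: A) u v = con A u v.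
    apply/idP/idP => [/con_setU1[//|[u1 v1]|[u1 v1]]|/sAh//].
      by apply: con_trans v1; apply: con_trans h12.
    by apply: con_trans v1; apply: con_trans u1 _; rewrite conC.
  have -> : common (h |: A) x = common A x.
    by apply/setP => c; rewrite !inE; apply: eq_forallb => y; rewrite hE.
  rewrite sumE; apply: leq_trans (IH x) _; rewrite leq_add2l.
  apply: leq_trans (leq_addl _ _); rewrite leq_eqVlt; apply/orP; left; apply/eqP.
  by apply: eq_bigl => a; rewrite hE.
have sI : common A h.1 :&: common A h.2 \subset common (h |: A) x.
  apply/subsetP => c; rewrite !inE => /andP[/forallP c1 /forallP c2].
  apply/forallP => y; apply/implyP => xy.
  have: con (h |: A) h.1 y by apply: con_trans xy; rewrite conC.
  case/con_setU1=> [h1y|[_ h2y]|[]].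
  - exact: (implyP (c1 y)).
  - exact: (implyP (c2 y)).
  - by rewrite (negPf h12).
have sU : common A h.1 :|: common A h.2 \subset L h.2 :|: (L h.1 :\: L h.2).
  apply/subsetP => c; rewrite !inE.
  case/orP=> /forallP H; first by have := implyP (H h.1) (con0 _ _) => ->; case: (_ \in _).
  by have := implyP (H h.2) (con0 _ _) => ->.
have := IH h.1; have := IH h.2.
have := subset_leq_card sI; have := subset_leq_card sU.
have := cardsUI (common A h.1) (common A h.2).
have : #|L h.2 :|: (L h.1 :\: L h.2)| <= k + alpha h.
  by rewrite -(L_k h.2); apply: leq_card_setU.
(* The edges of the two merged components form disjoint families, both inside the component of
   [x]. *)
suff : \sum_(a in A | con A h.1 a.1) alpha a + \sum_(a in A | con A h.2 a.1) alpha a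
   <= \sum_(a in A | con (h |: A) x a.1) alpha a by rewrite sumE; lia.
rewrite [leqRHS]big_mkcond [X in X + _]big_mkcond [X in _ + X]big_mkcond /= -big_split /=.
apply: leq_sum => a _; case: (a \in A) => //=.
case: ifP => a1; case: ifP => a2.
- by case/negP: h12; apply: con_trans a1 _; rewrite conC.
- by rewrite (con_trans xh (sAh _ _ a1)) addn0.
- by rewrite (con_trans xh (con_trans hh (sAh _ _ a2))).
- by [].
Qed.

Lemma common_le A a : a \in A -> #|common A a.1| + alpha a <= k.
Proof.
move=> aA; rewrite -(L_k a.1) -(cardsID (L a.2) (L a.1)) leq_add2r.
apply: subset_leq_card; apply/subsetP => c; rewrite !inE => /forallP c1.
by rewrite (implyP (c1 a.1)) ?(implyP (c1 a.2)) ?con0 ?con_edge.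
Qed.

Lemma common_root A x : common A (fingraph.root (adj A) x) = common A x.
Proof.
have xr : con A x (fingraph.root (adj A) x) by apply: connect_root.
apply/setP => c; rewrite !inE; apply: eq_forallb => y; congr (_ ==> _).
by apply/idP/idP; apply: con_trans => //; rewrite conC.
Qed.

Lemma card_common_le A x : #|common A x| <= k.
Proof.
rewrite -(L_k x); apply: subset_leq_card; apply/subsetP => c.
by rewrite inE => /forallP/(_ x)/implyP; apply; apply: con0.
Qed.

End Lists.

(** Weierstrass's inequality that a product of factors [1 - t i] is at least 1 minus the sum of the
    [t i], for [x i = K * (1 - t i)] and with denominators cleared. *)
Lemma prod_ge_sum (R : realFieldType) (I : Type) (s : seq I) (P : pred I)
    (x : I -> R) (K : R) :
  (0 < K)%R -> (forall i, P i -> 0 <= x i <= K)%R ->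
  (K ^+ count P s * (K - \sum_(i <- s | P i) (K - x i)) <= K * \prod_(i <- s | P i) x i)%R.
Proof.
move=> K0 x01; elim: s => [|i s IH].
  by rewrite !big_nil subr0 mulr1 mul1r.
rewrite !big_cons /=; case: ifP => Pi; last by rewrite add0n.
have /andP[x0 xK] := x01 i Pi.
have S0 : (0 <= \sum_(i <- s | P i) (K - x i))%R.
  by apply: sumr_ge0 => j /x01/andP[_]; rewrite subr_ge0.
rewrite mulrCA; apply: le_trans (ler_wpM2l x0 IH); rewrite add1n exprS.
set P0 := (K ^+ _)%R; set S := (\sum_(_ <- _ | _) _)%R in S0 *.
rewrite -subr_ge0.
have -> : (x i * (P0 * (K - S)) - K * P0 * (K - (K - x i + S)) = P0 * ((K - x i) * S))%R.
  by ring.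
by rewrite mulr_ge0 ?exprn_ge0 ?mulr_ge0 ?subr_ge0 // ltW.
Qed.

(** * Bounds on the number of maps constant along an edge set *)

Section Defect.

Variables (R : realFieldType) (V U : finType) (L : V -> {set U}) (k : nat).
Hypotheses (L_k : forall v, #|L v| = k) (k_gt0 : 0 < k) (c0 : U).
Implicit Types (A : {set V * V}).
Local Open Scope ring_scope.

Lemma sum_alpha_roots A :
  \sum_(r in fingraph.roots (adj A)) \sum_(a in A | con A r a.1) alpha L a =
  \sum_(a in A) alpha L a.
Proof.
rewrite (partition_big (fun a => fingraph.root (adj A) a.1)
  (mem (fingraph.roots (adj A)))) /=; last first.
  by move=> a _; apply: roots_root; apply: con_sym.
apply: eq_bigr => r /eqP rr; apply: eq_bigl => a; congr (_ && _).
by rewrite -{2}rr eq_sym root_con.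
Qed.

(** The product inequality over the components, each of which loses at most the [alpha] sum of its
    own edges by [common_ge]. *)
Lemma mono_maps_ge A :
  k%:R ^+ #|fingraph.roots (adj A)| * (k%:R - \sum_(a in A) (alpha L a)%:R)
    <= k%:R * #|mono_maps L A|%:R :> R.
Proof.
rewrite (card_mono_maps L c0) natr_prod.
have := @prod_ge_sum R V (index_enum V) (mem (fingraph.roots (adj A)))
  (fun r => #|common L A r|%:R) k%:R.
rewrite ltr0n => /(_ k_gt0) H; apply: le_trans (H _); last first.
  by move=> r _; rewrite ler0n ler_nat card_common_le.
rewrite -sum1_count sum1_card; apply: ler_wpM2l; first by rewrite exprn_ge0.
rewrite lerD2l lerN2 -natr_sum -sum_alpha_roots natr_sum; apply: ler_sum => r _.
by rewrite lerBlDl -natrD ler_nat common_ge.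
Qed.

(** The component of [a] contributes a factor at most [k - alpha L a], every other one at most
    [k]. *)
Lemma mono_maps_le A a : a \in A ->
  k%:R * #|mono_maps L A|%:R
    <= k%:R ^+ #|fingraph.roots (adj A)| * (k%:R - (alpha L a)%:R) :> R.
Proof.
move=> aA; rewrite (card_mono_maps L c0) natr_prod.
set r := fingraph.root (adj A) a.1.
have rr : r \in fingraph.roots (adj A) by apply: roots_root; apply: con_sym.
rewrite (bigD1 r) //= (cardD1 r) rr exprS -mulrA ler_pM2l ?ltr0n // mulrC.
apply: ler_pM; rewrite ?ler0n ?prodr_ge0 //.
  rewrite -prodr_const.
  apply: le_trans (_ : \prod_(i in [predD1 fingraph.roots (adj A) & r]) k%:R <= _) => //.
  rewrite (eq_bigl (mem [predD1 fingraph.roots (adj A) & r])); last first.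
    by move=> x; rewrite !inE andbC.
  by apply: ler_prod => x _; rewrite ler0n ler_nat card_common_le.
by rewrite /r common_root lerBrDr -natrD ler_nat common_le.
Qed.

End Defect.

(** * Edge sets without broken cycles *)

Section BrokenCycles.

Variables (V : finType) (E : {set V * V}).
Implicit Types (A B : {set V * V}) (g h : V * V) (x y z : V).

Definition above A h : {set V * V} := [set a in A | enum_rank h < enum_rank a].

(* If [h] is the least edge of a cycle, the rest of the cycle (a broken cycle)
   joins its ends in [above A h]; conversely such a path closes up with [h]. *)
Definition nbc A : bool := [forall h in E, ~~ con (above A h) h.1 h.2].
Definition NBC : {set {set V * V}} :=
  [set A : {set V * V} | (A \subset E) && nbc A].

Lemma in_above A h a : (a \in above A h) = (a \in A) && (enum_rank h < enum_rank a).
Proof. exact: in_set. Qed.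

Lemma above_sub A h : above A h \subset A.
Proof. by apply/subsetP => a; rewrite inE => /andP[]. Qed.

Lemma nbc_sub A B : B \subset A -> nbc A -> nbc B.
Proof.
move=> sBA /forall_inP A_nbc; apply/forall_inP => h hE; apply: contra (A_nbc h hE).
apply: con_sub; apply/subsetP => a; rewrite !inE => /andP[/(subsetP sBA)-> ->].
by [].
Qed.

Lemma NBC_sub A B : B \subset A -> A \in NBC -> B \in NBC.
Proof.
move=> sBA; rewrite !inE => /andP[sAE A_nbc].
by rewrite (subset_trans sBA) //= (nbc_sub sBA).
Qed.

Lemma nbc_setU1 A h : A \subset E -> h \in E -> nbc A ->
  (forall g, g \in E -> enum_rank g < enum_rank h ->
    con (above (h |: A) g) g.1 g.2 -> con A g.1 h.1 -> con A h.2 g.2 -> False) ->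
  (forall g, g \in E -> enum_rank g < enum_rank h ->
    con (above (h |: A) g) g.1 g.2 -> con A g.1 h.2 -> con A h.1 g.2 -> False) ->
  nbc (h |: A).
Proof.
move=> sAE hE /forall_inP A_nbc H1 H2; apply/forall_inP => g gE; apply/negP => gc.
case: (ltnP (enum_rank g) (enum_rank h)) => gh; last first.
  case/negP: (A_nbc g gE); apply: con_sub gc; apply/subsetP => a.
  rewrite !inE => /andP[/orP[/eqP->|aA] ga]; last by rewrite aA.
  by rewrite ltnNge gh in ga.
have sA : above (h |: A) g \subset h |: above A g.
  by apply/subsetP => a; rewrite !inE => /andP[/orP[->|->] ->]; rewrite ?orbT.
have := con_sub sA gc => /con_setU1[|[c1 c2]|[c1 c2]].
- by rewrite (negPf (A_nbc g gE)).
- by apply: (H1 g) => //; apply: con_sub (above_sub A g) _.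
- by apply: (H2 g) => //; apply: con_sub (above_sub A g) _.
Qed.

Lemma exists_min_edge A : A != set0 ->
  {h | h \in A & forall a, a \in A -> enum_rank h <= enum_rank a}.
Proof.
move=> A0; have /sig_eqW[h hA] : exists h, (h \in A) = true by apply/set0Pn.
by case: (arg_minnP (fun a => enum_rank a : nat) hA) => m mA mmin; exists m.
Qed.

Lemma enum_rank_neq g h : g != h -> enum_rank g <= enum_rank h -> enum_rank g < enum_rank h.
Proof.
move=> gh; rewrite leq_eqVlt => /orP[/eqP/val_inj/enum_rank_inj/eqP|//].
by rewrite (negPf gh).
Qed.

(** All other edges lie above the least edge [h], so they do not join its ends; induction applies to
    [A :\ h]. *)
Lemma NBC_forest A : A \in NBC -> forest A.
Proof.
have [n] := ubnP #|A|; elim: n A => // n IH A ltAn A_nbc.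
have [->|A0] := eqVneq A set0; first exact: forest0.
have [h hA hmin] := exists_min_edge A0.
rewrite -(setD1K hA); apply: forestU1.
  apply: IH; first by move: ltAn; rewrite (cardsD1 h) hA.
  by apply: NBC_sub A_nbc; apply: subD1set.
move: A_nbc; rewrite inE => /andP[/subsetP sAE /forall_inP/(_ h (sAE h hA))].
apply: contra; apply: con_sub; apply/subsetP => a; rewrite !inE => /andP[ah aA].
by rewrite aA enum_rank_neq ?hmin // eq_sym.
Qed.

(** * Whitney's broken cycle theorem for list colorings *)

Section Whitney.

Hypothesis E_irr : forall h, h \in E -> h.1 != h.2.

Variables (R : realFieldType) (U : finType) (L : V -> {set U}).

Definition toggle h A : {set V * V} := if h \in A then A :\ h else h |: A.

Lemma toggleK h : involutive (toggle h).
Proof.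
move=> A; rewrite /toggle; case hA: (h \in A); first by rewrite setD11 setD1K.
by rewrite setU11 setU1K // hA.
Qed.

Lemma sign_toggle h A : ((-1) ^+ #|toggle h A| = - (-1) ^+ #|A| :> R)%R.
Proof.
rewrite /toggle; case: ifP => hA.
  by rewrite [in RHS](cardsD1 h) hA add1n exprS mulN1r opprK.
by rewrite cardsU1 hA add1n exprS mulN1r.
Qed.

(** If [f] has no monochromatic edge, only the empty set counts. Otherwise toggling the least
    monochromatic edge is a sign-reversing involution of the index set. *)
Lemma sum_sign_nbc (C : eqType) (f : V -> C) :
  (\sum_(A in NBC | A \subset [set a in E | f a.1 == f a.2]) (-1) ^+ #|A|
   = ([forall a in E, f a.1 != f a.2])%:R :> R)%R.
Proof.
set Ef := [set a in E | _].
have -> : [forall a in E, f a.1 != f a.2] = (Ef == set0).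
  apply/forall_inP/eqP => [H|Ef0 a aE].
    by apply/setP => a; rewrite !inE; apply/negP => /andP[/H/negP].
  by have /negP := in_set0 a; rewrite -Ef0 inE aE => /negP.
have [->|Ef0] := eqVneq Ef set0.
  rewrite (big_pred1 set0) ?cards0 // => A; rewrite subset0 andbC /=.
  have [->|//] := eqVneq A set0; rewrite inE sub0set.
  apply/forall_inP => h hE; apply: contra (E_irr hE) => hc; apply/eqP.
  by apply: (@con_const _ _ id _ _ _ _ hc) => a; rewrite !inE.
have [h hEf hmin] := exists_min_edge Ef0.
have /andP[hE /eqP fh] : (h \in E) && (f h.1 == f h.2) by rewrite inE in hEf.
have toggle_stable A : (A \in NBC) && (A \subset Ef) ->
    (toggle h A \in NBC) && (toggle h A \subset Ef).
  move=> /andP[A_nbc sAEf]; rewrite /toggle; case: ifP => hA.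
    by rewrite (NBC_sub (subD1set A h)) // (subset_trans (subD1set A h)).
  rewrite subUset sub1set hEf sAEf andbT /=.
  move: A_nbc; rewrite !inE => /andP[sAE A_nbc].
  rewrite subUset sub1set hE sAE /=.
  have sE : h |: A \subset Ef by rewrite subUset sub1set hEf.
  (* An edge closing a path of monochromatic edges is itself monochromatic, so it cannot precede
     [h]. *)
  have min_h g : g \in E -> enum_rank g < enum_rank h ->
      con (above (h |: A) g) g.1 g.2 -> False.
    move=> gE gh gc; suff /hmin : g \in Ef by rewrite leqNgt gh.
    rewrite inE gE; apply/eqP; apply: (con_const _ gc) => a.
    by move=> /(subsetP (above_sub _ _))/(subsetP sE); rewrite inE => /andP[_ /eqP].
  by rewrite andbT; apply: nbc_setU1 => // g gE gh gc _ _; apply: (min_h g).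
set S := (\sum_(_ in _ | _) _)%R; suff : (S = - S)%R by rewrite mulr0n; lra.
rewrite {1}/S (reindex_inj (inv_inj (toggleK h))) /= -sumrN.
apply: eq_big => [A|A _]; last exact: sign_toggle.
apply/idP/idP => [/toggle_stable|]; last exact: toggle_stable.
by rewrite toggleK.
Qed.

Lemma whitney :
  (#|[set f in list_maps L | [forall a in E, f a.1 != f a.2]]|%:R
   = \sum_(A in NBC) (-1) ^+ #|A| * #|mono_maps L A|%:R :> R)%R.
Proof.
rewrite -sum1_card natr_sum big_mkcond /=.
(* For each list map [f], the indicator of being proper becomes the signed sum over the sets [A]
   along which [f] is constant. *)
rewrite (eq_bigr (fun f : {ffun V -> U} => \sum_(A in NBC)
  if f \in mono_maps L A then (-1) ^+ #|A| else 0)%R); last first.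
  move=> f _; rewrite inE; case fL: (f \in list_maps L) => /=; last first.
    by rewrite big1 // => A _; rewrite in_mono_maps fL.
  rewrite -[LHS]/(if _ then 1%:R else 0%:R)%R -(fun_if (fun n => n%:R)%R).
  rewrite -[(if _ then _ else _)]/(nat_of_bool _) -sum_sign_nbc big_mkcondr /=.
  apply: eq_bigr => A; rewrite in_mono_maps fL inE => /andP[sAE _] /=; congr (if _ then _ else _).
  apply/subsetP/forall_inP => [H a /H|H a aA]; first by rewrite inE => /andP[].
  by rewrite inE (subsetP sAE) ?H.
rewrite exchange_big /=; apply: eq_bigr => A _.
by rewrite -big_mkcond /= sumr_const mulr_natr.
Qed.

End Whitney.
End BrokenCycles.

(** * Double counting of extensions *)

Section Extensions.

Variables (V : finType) (E : {set V * V}).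
Implicit Types (A B : {set V * V}) (e g : V * V).

Definition extensions B : {set V * V} := [set g in E :\: B | nbc E (g |: B)].

Lemma extensionsP B g : B \in NBC E ->
  (g \in extensions B) = (g \notin B) && (g |: B \in NBC E).
Proof.
by rewrite !inE subUset sub1set => /andP[-> _]; rewrite andbT andbA.
Qed.

(** Both sides sum over the pairs of a set [A] and an edge [g != e] of [A]; on the right the pair is
    given by [B = A :\ g] and its extension [g]. *)
Lemma sum_extensions (R : pzSemiRingType) (phi : nat -> R) e :
  (\sum_(A in NBC E | e \in A) phi #|A| *+ #|A|.-1 =
   \sum_(B in NBC E | e \in B) phi #|B|.+1 *+ #|extensions B|)%R.
Proof.
transitivity (\sum_(A in NBC E | e \in A) \sum_(g in A :\ e) phi #|A|)%R.
  apply: eq_bigr => A /andP[_ eA]; rewrite sumr_const; congr (_ *+ _)%R.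
  by rewrite (cardsD1 e A) eA.
rewrite [RHS](eq_bigr (fun B => \sum_(g in extensions B) phi #|B|.+1)%R); last first.
  by move=> B _; rewrite sumr_const.
rewrite (exchange_big_dep (fun g => g != e)) /=; last first.
  by move=> A g _; rewrite !inE => /andP[].
rewrite [RHS](exchange_big_dep (fun g => g != e)) /=; last first.
  move=> B g /andP[B_nbc eB]; rewrite extensionsP // => /andP[gB _].
  by apply: contra gB => /eqP->.
apply: eq_bigr => g ge.
rewrite (reindex_onto (fun B => g |: B) (fun A => A :\ g)) /=; last first.
  by move=> A /andP[_]; rewrite !inE => /andP[_]; apply: setD1K.
apply: eq_big => [B|B].
  rewrite !in_setD1 ge setU11 in_setU1 eq_sym (negPf ge) /= andbT.
  case: (boolP (g \in B)) => gB.
    rewrite (_ : (_ :\ g == B) = false) ?andbF; last first.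
      by apply/eqP => E0; have := setD11 g (g |: B); rewrite E0 gB.
    case B_nbc: (B \in NBC E) => //=; rewrite extensionsP // gB /= ?andbF //.
  rewrite setU1K // eqxx andbT.
  case B_nbc: (B \in NBC E) => /=; first by rewrite extensionsP // gB andbC.
  by apply/negP => /andP[/(NBC_sub (subsetU1 g B))]; rewrite B_nbc.
case/andP=> _ /eqP BE; rewrite -{2}BE; congr phi.
by rewrite [LHS](cardsD1 g) setU11.
Qed.

End Extensions.

(* [k * weight i] is the number of colorings of the forests with [i] edges. *)
Definition weight (R : realFieldType) (n k i : nat) : R :=
  (k%:R ^ (n%:Z - i%:Z - 1))%R.

(** * Expansion of the difference of the two counts over edge sets *)

Section Expansion.

Variables (R : realFieldType) (V U : finType) (E : {set V * V}).
Variables (L : V -> {set U}) (k : nat).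
Hypotheses (L_k : forall v, #|L v| = k) (k_gt0 : 0 < k) (c0 : U).
Hypothesis E_irr : forall h, h \in E -> h.1 != h.2.
Implicit Types (A B : {set V * V}) (e g : V * V).
Local Open Scope ring_scope.

Local Notation K := (k%:R : R).
Local Notation weight := (weight R #|V| k).

Lemma weightS i : weight i = K * weight i.+1.
Proof.
rewrite /weight -{2}(expr1z K) -expfzDr ?pnatr_eq0 -?lt0n //.
by congr (_ ^ _); lia.
Qed.

Lemma weight_gt0 i : 0 < weight i.
Proof. by rewrite exprz_gt0 ?ltr0n. Qed.

(** A set in [NBC E] is a forest, so it has [#|V| - #|A|] components. *)
Lemma expr_roots A : A \in NBC E ->
  K ^+ #|fingraph.roots (adj A)| = K * weight #|A|.
Proof.
move=> /NBC_forest/forest_card_roots AV.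
rewrite /weight -{2}(expr1z K) -expfzDr ?pnatr_eq0 -?lt0n // -AV.
by rewrite exprnP; congr (_ ^ _); lia.
Qed.

Lemma defect_le A : A \in NBC E ->
  K * weight #|A| - #|mono_maps L A|%:R <= weight #|A| * \sum_(a in A) (alpha L a)%:R.
Proof.
move=> A_nbc; have := mono_maps_ge R L_k k_gt0 c0 A; rewrite expr_roots //.
have K0 : 0 < K by rewrite ltr0n.
rewrite -mulrA ler_pM2l //; lra.
Qed.

Lemma defect_ge A a : A \in NBC E -> a \in A ->
  weight #|A| * (alpha L a)%:R <= K * weight #|A| - #|mono_maps L A|%:R.
Proof.
move=> A_nbc aA; have := mono_maps_le R L_k k_gt0 c0 aA; rewrite expr_roots //.
have K0 : 0 < K by rewrite ltr0n.
rewrite -mulrA ler_pM2l //; lra.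
Qed.

(** The coefficient of [alpha L a] in the lower bound for the signed defect of a set of size [i]
    containing [a]: odd sizes average the bounds of [defect_ge], even sizes negate the bound of
    [defect_le]. *)
Definition coeff (i : nat) : R := if odd i then weight i / i%:R else - weight i.

Lemma signed_defect_ge A : A \in NBC E ->
  \sum_(a in A) (alpha L a)%:R * coeff #|A| <=
  (-1) ^+ #|A| * (#|mono_maps L A|%:R - K * weight #|A|).
Proof.
move=> A_nbc; rewrite -signr_odd /coeff; case: ifP => Aodd; last first.
  have := defect_le A_nbc; rewrite -mulr_suml expr0; lra.
rewrite expr1 mulN1r opprB.
have A0 : (0 < #|A|)%N by rewrite lt0n; case: #|A| Aodd.
have A0R : #|A|%:R != 0 :> R by rewrite pnatr_eq0 -lt0n.
set D := _ - _; have -> : D = \sum_(a in A) D / #|A|%:R.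
  by rewrite sumr_const -[LHS](divfK A0R) mulr_natr.
apply: ler_sum => a aA; rewrite mulrA ler_pM2r ?invr_gt0 ?ltr0n // mulrC.
exact: defect_ge.
Qed.

(** The negative coefficient of an even set [A] is spread evenly over the [#|A| - 1] odd sets
    [A :\ g] with [g != e]; [weightS] then gives both contributions to [B] the same weight. *)
Lemma sum_coeff e : \sum_(A in NBC E | e \in A) coeff #|A| =
  \sum_(B in NBC E | (e \in B) && odd #|B|)
    weight #|B|.+1 / #|B|%:R * (k%:R - #|extensions E B|%:R).
Proof.
(* The share charged by one even set; an even set containing [e] has size at least 2, so the
   denominator is nonzero. *)
pose phi i := if odd i then 0 else weight i / i.-1%:R.
have := sum_extensions E phi e.
rewrite (eq_bigr (fun A : {set V * V} => if odd #|A| then 0 else weight #|A|)); last first.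
  move=> A /andP[_ eA]; rewrite /phi; case: ifP => Aodd; first by rewrite mul0rn.
  have : (1 < #|A|)%N by rewrite (cardsD1 e) eA in Aodd *; case: #|_| Aodd.
  by move=> A1; rewrite -mulr_natr divfK // pnatr_eq0; lia.
move=> E1.
rewrite (eq_bigr (fun A : {set V * V} => (if odd #|A| then weight #|A| / #|A|%:R else 0) -
  (if odd #|A| then 0 else weight #|A|))); last first.
  by move=> A _; rewrite /coeff; case: ifP; rewrite ?subr0 ?sub0r.
rewrite sumrB E1 -sumrB.
rewrite [RHS](eq_bigl (fun B => ((B \in NBC E) && (e \in B)) && odd #|B|)); last first.
  by move=> B; rewrite andbA.
rewrite [RHS]big_mkcondr /=; apply: eq_bigr => B _; rewrite /phi /=.
case: (odd #|B|) => /=; last by rewrite mul0rn subrr.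
by rewrite weightS -[_ *+ _]mulr_natr; ring.
Qed.

Lemma sum_signed_defects_ge :
  \sum_(e in E) (alpha L e)%:R *
    \sum_(B in NBC E | (e \in B) && odd #|B|)
      weight #|B|.+1 / #|B|%:R * (k%:R - #|extensions E B|%:R)
  <= \sum_(A in NBC E) (-1) ^+ #|A| * (#|mono_maps L A|%:R - K * weight #|A|).
Proof.
apply: le_trans (ler_sum _ signed_defect_ge).
rewrite (exchange_big_dep (mem E)) /=; last first.
  by move=> A a; rewrite inE => /andP[/subsetP sAE _] /sAE.
by apply: ler_sum => e _; rewrite -mulr_sumr sum_coeff.
Qed.

End Expansion.

(** * Two-element sets, and the size of a component *)

Lemma eq_set2 (T : finType) (a b c d : T) : [set a; b] = [set c; d] ->
  (a = c /\ b = d) \/ (a = d /\ b = c).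
Proof.
move=> E0; have : a \in [set c; d] by rewrite -E0 set21.
have : b \in [set c; d] by rewrite -E0 set22.
have : c \in [set a; b] by rewrite E0 set21.
have : d \in [set a; b] by rewrite E0 set22.
by do 4![case/set2P=> ?; subst]; auto.
Qed.

Lemma set2_neq (T : finType) (a b c d : T) : a != b -> [set a; b] = [set c; d] -> c != d.
Proof. by move=> ab /eq_set2[[<- <-]|[<- <-]]; rewrite // eq_sym. Qed.

(** This is [common_ge] for the lists [~: [set y]]: the common colors are the vertices outside the
    component, and each [alpha] is at most 1. *)
Lemma card_component_le (V : finType) (A : {set V * V}) (x : V) :
  #|[set y | con A x y]| <= 1 + #|[set a in A | con A x a.1]|.
Proof.
pose L (y : V) : {set V} := ~: [set y].
have L_k v : #|L v| = #|V|.-1 by rewrite cardsC1.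
have := common_ge L_k A x.
have -> : common L A x = ~: [set y | con A x y].
  apply/setP => c; rewrite !inE; apply/forallP/idP => [H|xc y].
    by apply/negP => xc; have := implyP (H c) xc; rewrite !inE eqxx.
  by apply/implyP => xy; rewrite !inE; apply: contra xc => /eqP->.
have : \sum_(a in A | con A x a.1) alpha L a <= #|[set a in A | con A x a.1]|.
  rewrite -sum1_card (eq_bigl [in [set a in A | con A x a.1]]); last first.
    by move=> a; rewrite !inE.
  apply: leq_sum => a _; rewrite /alpha /L -(cards1 a.2); apply: subset_leq_card.
  by apply/subsetP => c; rewrite !inE negbK => /andP[].
have := cardsC [set y | con A x y].
have : 0 < #|V| by apply/card_gt0P; exists x.
lia.
Qed.

(** * Chords and parallel edges in a simple graph *)

Section SimpleGraph.

Variables (V : finType) (E : {set V * V}).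
Hypothesis E_irr : forall h, h \in E -> h.1 != h.2.
Hypothesis E_asym : forall x y, (x, y) \in E -> (y, x) \notin E.
Implicit Types (A B : {set V * V}) (e g h : V * V) (x y z : V).

Definition ends h : {set V} := [set h.1; h.2].

Lemma ends_inj : {in E &, injective ends}.
Proof.
move=> [x y] [u v] hE gE /eq_set2[[/= -> ->]//|[/= xv yu]].
by move: (E_asym hE); rewrite xv yu gE.
Qed.

Lemma con_set1 b x y : con [set b] x y -> x = y \/ [set x; y] = ends b.
Proof.
have con_set0 u v : con set0 u v -> u = v :> V.
  by move=> uv; apply: (@con_const _ _ id _ _ _ _ uv) => a; rewrite inE.
rewrite -(setU0 [set b]); case/con_setU1=> [/con_set0|[]|[]]; first by left.
  by move=> /con_set0-> /con_set0<-; right.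
by move=> /con_set0-> /con_set0<-; right; rewrite setUC.
Qed.

(** A chord closes a triangle with [b1] and [b2], so its ends are the symmetric difference of
    theirs; hence there is at most one chord. *)
Lemma chord_ends b1 b2 g : b1 \in E -> b2 \in E -> g \in E ->
  g != b1 -> g != b2 -> con [set b1; b2] g.1 g.2 ->
  ends g = (ends b1 :\: ends b2) :|: (ends b2 :\: ends b1).
Proof.
move=> b1E b2E gE gb1 gb2.
have gN b : b \in E -> g != b -> ends g <> ends b.
  by move=> bE gb /ends_inj gbE; rewrite gbE // eqxx in gb.
have {gb1} n1 := gN _ b1E gb1; have {gb2} n2 := gN _ b2E gb2.
have g12 := E_irr gE; have b12 := E_irr b1E; have b22 := E_irr b2E.
(* Here [z] is the vertex shared by [b1] and [b2]. *)
have key z x y : ends g = [set x; y] -> x != y ->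
    ends b1 = [set x; z] -> ends b2 = [set z; y] ->
    ends g = (ends b1 :\: ends b2) :|: (ends b2 :\: ends b1).
  move=> gxy xy b1z b2z; rewrite gxy b1z b2z.
  have xz := set2_neq b12 b1z; have zy := set2_neq b22 b2z.
  apply/setP => v; rewrite !inE.
  have [->|vx] := eqVneq v x; first by rewrite (negPf xz) (negPf xy).
  have [->|vy] := eqVneq v y; first by rewrite eq_sym (negPf zy) orbT.
  by case: (v == z).
have gC : ends g = [set g.2; g.1] by rewrite setUC.
have b1C : ends b1 = [set b1.2; b1.1] by rewrite setUC.
case/con_setU1=> [/con_set1[E0|//]|[/con_set1 c1 /con_set1 c2]|[/con_set1 c1 /con_set1 c2]].
- by rewrite E0 eqxx in g12.
- case: c1 => [E1|E1]; case: c2 => [E2|E2].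
  + by case: n1; rewrite /ends E1 E2.
  + by apply: (key b1.2 g.1 g.2) => //; rewrite E1.
  + by apply: (key b1.1 g.2 g.1); rewrite // 1?eq_sym // -?E2 // -?E1 setUC.
  + move: E1; rewrite -E2 => /eq_set2[[E3 E4]|[E3 _]].
      by case: n1; rewrite gC b1C E3 E4 setUC.
    by rewrite E3 eqxx in g12.
- case: c1 => [E1|E1]; case: c2 => [E2|E2].
  + by case: n1; rewrite b1C /ends E1 E2.
  + by apply: (key b1.1 g.1 g.2) => //; rewrite E1.
  + by apply: (key b1.2 g.2 g.1); rewrite // 1?eq_sym // -?E2 // -?E1 setUC.
  + move: E1; rewrite -E2 => /eq_set2[[E3 E4]|[E3 _]].
      by case: n1; rewrite /ends E3 E4.
    by rewrite E3 eqxx in g12.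
Qed.

Lemma card_chords_le B : B \subset E -> #|B| = 2 ->
  #|[set g in E :\: B | con B g.1 g.2]| <= 1.
Proof.
move=> sBE /eqP/cards2P[b1 [b2 [b12 BE]]]; rewrite BE in sBE *.
have b1E : b1 \in E by apply: (subsetP sBE); rewrite set21.
have b2E : b2 \in E by apply: (subsetP sBE); rewrite set22.
apply/card_le1P => g; rewrite !inE negb_or -!andbA => /and4P[g1 g2 gE gc] h.
rewrite inE; apply/idP/eqP => [|->]; last by rewrite !inE negb_or g1 g2 gE gc.
rewrite !inE negb_or -!andbA => /and4P[h1 h2 hE hc].
by apply: ends_inj => //; rewrite (chord_ends b1E b2E gE) ?(chord_ends b1E b2E hE).
Qed.

(** * Edges after contraction of [B] *)

Section Contraction.

Variable B : {set V * V}.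

(* The edges with the same pair of roots are parallel after contracting [B]. *)
Definition parallel g h : bool :=
  [set fingraph.root (adj B) g.1; fingraph.root (adj B) g.2]
  == [set fingraph.root (adj B) h.1; fingraph.root (adj B) h.2].

Lemma parallelP g h : reflect
  ((con B g.1 h.1 /\ con B g.2 h.2) \/ (con B g.1 h.2 /\ con B g.2 h.1)) (parallel g h).
Proof.
rewrite /parallel; apply: (iffP eqP) => [/eq_set2[[/eqP + /eqP]|[/eqP + /eqP]]|].
- by rewrite !root_con; left.
- by rewrite !root_con; right.
- by rewrite -!root_con => -[[/eqP-> /eqP->]//|[/eqP-> /eqP->]]; rewrite setUC.
Qed.

Lemma parallel_con g h : parallel g h -> con B g.1 g.2 = con B h.1 h.2.
Proof.
have H u v : parallel u v -> con B u.1 u.2 -> con B v.1 v.2.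
  move=> /parallelP[[c1 c2]|[c1 c2]] c.
    by apply: con_trans c2; rewrite conC in c1; apply: con_trans c.
  by rewrite conC in c2; apply: con_trans c2 _; rewrite conC in c; apply: con_trans c c1.
by move=> gh; apply/idP/idP; apply: H; rewrite // /parallel eq_sym.
Qed.

(** The least edge [h] of the parallel class works: an edge closing a broken cycle created by [h]
    would be parallel to [h] and smaller. *)
Lemma exists_parallel_extension g : B \in NBC E -> g \in E -> ~~ con B g.1 g.2 ->
  exists2 h, h \in extensions E B & parallel g h.
Proof.
move=> B_nbc gE gB; pose P := [set h in E | parallel g h].
have P0 : P != set0 by apply/set0Pn; exists g; rewrite inE gE /parallel eqxx.
have [h] := exists_min_edge P0; rewrite inE => /andP[hE gh] hmin; exists h => //.
move: (B_nbc); rewrite inE => /andP[sBE nbcB].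
have hB : ~~ con B h.1 h.2 by rewrite -(parallel_con gh).
rewrite !inE hE andbT; apply/andP; split.
  by apply: contra hB; apply: con_edge.
have H f : f \in E -> enum_rank f < enum_rank h -> parallel h f -> False.
  move=> fE fh hf; have := hmin f; rewrite inE fE leqNgt fh /=.
  by rewrite /parallel (eqP gh) => /(_ hf).
apply: nbc_setU1 => // f fE fh _ c1 c2; apply: (H f) => //; apply/parallelP.
  by left; rewrite conC.
by right; split; rewrite // conC.
Qed.

(** Orienting each parallel edge from the component of [g.1] to that of [g.2] is injective, as [E]
    holds each edge in one orientation only. *)
Lemma card_parallel_le g : ~~ con B g.1 g.2 ->
  #|[set h in E | parallel h g]|
    <= #|[set y | con B g.1 y]| * #|[set y | con B g.2 y]|.
Proof.
move=> gB; rewrite -cardsX.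
pose f h := if con B h.1 g.1 then h else (h.2, h.1).
rewrite -(@card_in_imset _ _ f [set h in E | parallel h g]) => [|h h'].
  apply: subset_leq_card; apply/subsetP => _ /imsetP[h + ->].
  rewrite inE => /andP[_ /parallelP hg]; rewrite !inE /f /=.
  case: ifP => h1 /=; case: hg => -[c1 c2]; rewrite 1?(conC B g.1) 1?(conC B g.2).
  - by rewrite c1.
  - case/negP: gB; rewrite conC in h1; exact: con_trans h1 c1.
  - by rewrite c1 in h1.
  - by rewrite c1 c2.
rewrite !inE /f => /andP[hE _] /andP[h'E _].
case: ifP => _; case: ifP => _ //.
- by move: hE h'E; case: h h' => [x y] [u v] hE h'E [xv yu];
     move: (E_asym hE); rewrite xv yu h'E.
- by move: hE h'E; case: h h' => [x y] [u v] hE h'E [xv yu];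
     move: (E_asym h'E); rewrite -xv -yu hE.
- by case: h h' {hE h'E} => [x y] [u v] [-> ->].
Qed.

(** The two components have at most [1 + i] and [1 + j] vertices, where [i + j <= 2]. *)
Lemma card_parallel_le4 g : #|B| = 2 -> ~~ con B g.1 g.2 ->
  #|[set h in E | parallel h g]| <= 4.
Proof.
move=> B2 gB; apply: leq_trans (card_parallel_le gB) _.
have := card_component_le B g.1; have := card_component_le B g.2.
suff : #|[set a in B | con B g.1 a.1]| + #|[set a in B | con B g.2 a.1]| <= 2.
  move: #|_| #|_| #|_| #|_| => a b c d; nia.
rewrite -B2 -cardsUI (_ : _ :&: _ = set0).
  by rewrite cards0 addn0; apply: subset_leq_card; apply/subsetP => a;
    rewrite !inE => /orP[] /andP[].
apply/setP => a; rewrite !inE; apply: contraNF gB => /andP[/andP[_ c1] /andP[_ c2]].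
by apply: con_trans c1 _; rewrite conC.
Qed.

(** Apart from the 2 edges of [B] and at most one chord, each edge is sent to a parallel extension,
    and at most 4 edges go to the same one. *)
Lemma card_extensions2_ge : B \in NBC E -> #|B| = 2 ->
  #|E| <= 4 * #|extensions E B| + 3.
Proof.
move=> B_nbc B2; have sBE : B \subset E by move: B_nbc; rewrite inE => /andP[].
pose D := [set g in E :\: B | ~~ con B g.1 g.2].
have EB : #|E| = 2 + #|E :\: B| by rewrite -B2 -(cardsID B E) (setIidPr sBE).
have ED : #|E :\: B| = #|[set g in E :\: B | con B g.1 g.2]| + #|D|.
  rewrite -(cardsID [set g | con B g.1 g.2] (E :\: B)); congr (_ + _); apply: eq_card => g.
    by rewrite !inE.
  by rewrite !inE andbC.
have := card_chords_le sBE B2.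
suff : #|D| <= 4 * #|extensions E B| by lia.
(* The default [g] is never taken on [D]. *)
pose f g := odflt g [pick h in extensions E B | parallel g h].
have fP g : g \in D -> f g \in extensions E B /\ parallel g (f g).
  rewrite /f inE => /andP[/setDP[gE _] gc].
  case: pickP => [h /andP[hE gh] //|].
  by have [h hE gh] := exists_parallel_extension B_nbc gE gc => /(_ h); rewrite hE gh.
rewrite -sum1_card (partition_big f (mem (extensions E B))) => [|g /fP[]//].
rewrite mulnC -sum_nat_const; apply: leq_sum => h hE.
rewrite sum1dep_card.
have [->|[g]] := set_0Vmem [set g in D | f g == h]; first by rewrite cards0.
rewrite inE => /andP[gD /eqP gh]; have [_] := fP g gD; rewrite gh => g_h.
have hc : ~~ con B h.1 h.2.
  by rewrite -(parallel_con g_h); move: gD; rewrite inE => /andP[].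
apply: leq_trans (card_parallel_le4 B2 hc); apply: subset_leq_card.
apply/subsetP => g'; rewrite inE => /andP[g'D /eqP <-].
have [_ g'f] := fP g' g'D; rewrite inE g'f andbT.
by move: g'D; rewrite inE => /andP[/setDP[]].
Qed.

End Contraction.

End SimpleGraph.

(** * Four-cycles in triangle-free graphs *)

Section TriangleFree.

Variables (V : finType) (E : {set V * V}).
Hypothesis E_irr : forall h, h \in E -> h.1 != h.2.
Hypothesis E_asym : forall x y, (x, y) \in E -> (y, x) \notin E.
Hypothesis E_tf : forall x y z, ~ [/\ adj E x y, adj E y z & adj E x z].
Implicit Types (A B : {set V * V}) (e g h : V * V) (x y z : V).

Lemma adj_ends A x y : adj A x y -> exists2 a, a \in A & ends a = [set x; y].
Proof.
by case/orP=> xyA; [exists (x, y)|exists (y, x)]; rewrite // /ends setUC.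
Qed.

Lemma adj_sub A B x y : A \subset B -> adj A x y -> adj B x y.
Proof. by move=> /subsetP sAB /orP[] /sAB xyB; rewrite /adj /= xyB ?orbT. Qed.

Lemma adj_neq x y : adj E x y -> x != y.
Proof. by case/orP=> /E_irr; rewrite // eq_sym. Qed.

Definition cycle4 x1 x2 x3 x4 : {set V * V} :=
  [set h in E | ends h \in
    [:: [set x1; x2]; [set x2; x3]; [set x3; x4]; [set x4; x1]]].

(** For a cycle, this is its broken cycle. *)
Definition nonmin A : {set V * V} :=
  [set a in A | [exists h in A, enum_rank h < enum_rank a]].

Definition broken4 A x1 x2 x3 x4 : Prop :=
  [/\ uniq [:: x1; x2; x3; x4],
      [/\ adj E x1 x2, adj E x2 x3, adj E x3 x4 & adj E x4 x1]
    & A = nonmin (cycle4 x1 x2 x3 x4)].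

Lemma broken4_rot A x1 x2 x3 x4 : broken4 A x1 x2 x3 x4 -> broken4 A x2 x3 x4 x1.
Proof.
move=> [xU [x12 x23 x34 x41] AE]; split=> //.
  by rewrite -(rot_uniq 1) in xU.
rewrite AE; congr nonmin; apply/setP => h; rewrite !inE; congr (_ && _).
by do 4!case: (_ == _).
Qed.

Lemma broken4_rev A x1 x2 x3 x4 : broken4 A x1 x2 x3 x4 -> broken4 A x2 x1 x4 x3.
Proof.
move=> [xU [x12 x23 x34 x41] AE]; split; try by split; rewrite adj_sym.
  by rewrite -rev_uniq -(rot_uniq 2) in xU.
rewrite AE; congr nonmin; apply/setP => h; rewrite !inE; congr (_ && _).
rewrite (setUC [set x2] [set x1]) (setUC [set x1] [set x4]).
rewrite (setUC [set x4] [set x3]) (setUC [set x3] [set x2]).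
by do 4!case: (_ == _).
Qed.

(** Some [h] is joined by a path in [above A h]; without triangles this path has three edges, hence
    is all of [A], and [h] is the least edge of the resulting 4-cycle. *)
Lemma broken4P A : A \subset E -> #|A| = 3 -> ~~ nbc E A ->
  exists x1 x2 x3 x4, broken4 A x1 x2 x3 x4.
Proof.
move=> sAE A3; rewrite negb_forall_in => /exists_inP[h hE]; rewrite negbK.
case/connectP => p0 p0P; case: (shortenP p0P) => p pP pU _ pE.
have sA := above_sub A h.
have pcon : [set y in h.1 :: p] \subset [set y | con (above A h) h.1 y].
  by apply/subsetP => y; rewrite !inE => yp; apply: path_connect pP _ _.
(* A component of at most three edges has at most four vertices. *)
have p4 : size p <= 3.
  have := subset_leq_card pcon; rewrite cardsE (card_uniqP pU) /=.
  have := card_component_le (above A h) h.1.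
  have : #|[set a in above A h | con (above A h) h.1 a.1]| <= #|A|.
    by apply: subset_leq_card; apply/subsetP => a; rewrite !inE => /andP[/andP[]].
  lia.
have hh : (h.1, h.2) = h by case: (h).
(* Length 0 would make [h] a loop, length 1 would repeat [h] or reverse it, and length 2 would close
   a triangle. *)
case: p pP pU pE p4 {pcon p0P} => [|z1 [|z2 [|y []]]] //= + + yE _.
- by have := E_irr hE; rewrite yE eqxx.
- rewrite -yE andbT => /orP[] H _.
    by move: H; rewrite hh in_above ltnn andbF.
  move: hE; rewrite -{1}hh => /E_asym; move: H => /(subsetP sA)/(subsetP sAE) ->.
  by [].
- rewrite -yE andbT => /andP[c1 c2] _; case: (@E_tf h.1 z1 h.2); split.
  + exact: adj_sub (subset_trans sA sAE) c1.
  + exact: adj_sub (subset_trans sA sAE) c2.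
  + by rewrite /adj /= hh hE.
rewrite -yE !andbT => /and3P[c1 c2 c3] xU.
have sE := subset_trans sA sAE.
exists h.1, z1, z2, h.2; split; first by rewrite /= andbT.
  split; try exact: adj_sub sE _.
  by rewrite /adj /= hh hE orbT.
have [a1 a1A e1] := adj_ends c1; have [a2 a2A e2] := adj_ends c2.
have [a3 a3A e3] := adj_ends c3.
move: xU; rewrite /= !inE !negb_or -!andbA.
case/and5P=> x1 x2 x3 x4 /andP[x5 x6].
have a12 : a1 != a2.
  apply/eqP => a12; move: e2; rewrite -a12 e1 => /eq_set2[[/eqP]|[/eqP]].
    by rewrite (negPf x1).
  by rewrite (negPf x2).
have a23 : a2 != a3.
  apply/eqP => a23; move: e3; rewrite -a23 e2 => /eq_set2[[/eqP]|[/eqP]].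
    by rewrite (negPf x4).
  by rewrite (negPf x5).
have a13 : a1 != a3.
  apply/eqP => a13; move: e3; rewrite -a13 e1 => /eq_set2[[/eqP]|[/eqP]].
    by rewrite (negPf x2).
  by rewrite (negPf x3).
have AE : A = [set a1; a2; a3].
  apply/esym/eqP; rewrite eqEcard A3 !subUset !sub1set.
  rewrite !(subsetP sA) // -setUA cardsU1 cards2 a23 !inE negb_or a12 a13.
  by [].
have above_h a : a \in A -> enum_rank h < enum_rank a.
  rewrite AE !inE -orbA => /or3P[] /eqP->; [move: a1A|move: a2A|move: a3A];
    by rewrite in_above => /andP[].
have hK : h \in cycle4 h.1 z1 z2 h.2.
  by rewrite !inE hE /= (setUC [set h.2]) eqxx !orbT.
have KE a : (a \in cycle4 h.1 z1 z2 h.2) = (a == h) || (a \in A).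
  apply/idP/orP => [|[/eqP->//|]].
    rewrite inE -e1 -e2 -e3 (setUC [set h.2]) -/(ends h) !inE => /andP[aE].
    have inj b : b \in E -> ends a == ends b -> a = b.
      by move=> bE /eqP; apply: (ends_inj E_asym).
    have bE b : b \in above A h -> b \in E by apply: subsetP.
    rewrite AE !inE.
    by case/or4P=> /inj-> //; rewrite ?eqxx ?orbT; auto.
  move=> aA; rewrite !inE (subsetP sAE) //=; move: aA; rewrite AE !inE -orbA.
  by case/or3P=> /eqP->; rewrite ?e1 ?e2 ?e3 eqxx ?orbT.
apply/setP => a; rewrite [RHS]in_set KE.
apply/idP/andP => [aA|[/orP[/eqP->|//] /exists_inP[b]]].
  by rewrite aA orbT; split=> //; apply/exists_inP; exists h => //; apply: above_h.
rewrite KE => /orP[/eqP->|/above_h hb]; first by rewrite ltnn.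
by rewrite ltnNge (ltnW hb).
Qed.

Section EdgeDegrees.

Variables (u v : V).
Hypothesis uvE : (u, v) \in E.

(* [pq] is the edge opposite to [uv] in the 4-cycle u, v, q, p. *)
Definition squares : {set V * V} :=
  [set pq | [&& adj E u pq.1, pq.1 != v, adj E v pq.2, pq.2 != u & adj E pq.1 pq.2]].

(** The edge [uv] is a side of the cycle; rotations and a reflection make it the first one. *)
Lemma broken4_square A : (u, v) \in A -> (exists x1 x2 x3 x4, broken4 A x1 x2 x3 x4) ->
  exists2 pq, pq \in squares & A = nonmin (cycle4 u v pq.2 pq.1).
Proof.
move=> uvA [x1 [x2 [x3 [x4 b1]]]].
have H y1 y2 y3 y4 : broken4 A y1 y2 y3 y4 -> u = y1 -> v = y2 ->
    exists2 pq, pq \in squares & A = nonmin (cycle4 u v pq.2 pq.1).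
  move=> [yU [y12 y23 y34 y41] AE] uy vy; exists (y4, y3); last by rewrite uy vy.
  rewrite !inE /= uy vy y23 [adj E y1 y4]adj_sym y41 [adj E y4 y3]adj_sym y34 !andbT /=.
  move: yU; rewrite /= !inE !negb_or -!andbA => /and5P[_ n2 _ _ /andP[n5 _]].
  by rewrite eq_sym n5 eq_sym n2.
have H2 y1 y2 y3 y4 : broken4 A y1 y2 y3 y4 -> [set u; v] = [set y1; y2] ->
    exists2 pq, pq \in squares & A = nonmin (cycle4 u v pq.2 pq.1).
  move=> b /eq_set2[[uy vy]|[uy vy]]; first exact: H b _ _.
  exact: H (broken4_rev b) _ _.
have b2 := broken4_rot b1; have b3 := broken4_rot b2; have b4 := broken4_rot b3.
have : (u, v) \in cycle4 x1 x2 x3 x4.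
  by case: b1 => _ _ AE; move: uvA; rewrite AE in_set => /andP[].
rewrite !inE => /andP[_ /or4P[]/eqP].
- exact: H2 b1.
- exact: H2 b2.
- exact: H2 b3.
- exact: H2 b4.
Qed.

Definition nbrs x y : {set V} := [set p | adj E x p & p != y].

Lemma card_squares_le : #|squares| <= #|nbrs u v| * #|nbrs v u|.
Proof.
rewrite -cardsX; apply: subset_leq_card; apply/subsetP => -[p q].
by rewrite !inE /= => /and5P[-> -> -> ->].
Qed.

(** The edges, seen as pairs of ends, fall into four classes according to whether they contain [u]
    and whether they contain [v]; each summand bounds one class from below. *)
Lemma card_squares_nbrs_le : 1 + #|nbrs u v| + #|nbrs v u| + #|squares| <= #|E|.
Proof.
have uv : u != v by apply: E_irr uvE.
pose F := @ends V @: E.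
have <- : #|F| = #|E| by apply: card_in_imset; apply: ends_inj E_asym.
have adjF x y : adj E x y -> [set x; y] \in F.
  by move=> /adj_ends[a aE <-]; apply: imset_f.
pose Fu := [set S in F | u \in S]; pose Fn := [set S in F | u \notin S].
have FE : #|F| = #|Fu| + #|Fn|.
  rewrite -(cardsID [set S : {set V} | u \in S] F); congr (_ + _).
    by apply: eq_card => S; rewrite !inE.
  by apply: eq_card => S; rewrite !inE andbC.
have FuE : #|Fu| = #|[set S in Fu | v \in S]| + #|[set S in Fu | v \notin S]|.
  rewrite -(cardsID [set S : {set V} | v \in S] Fu); congr (_ + _).
    by apply: eq_card => S; rewrite !inE.
  by apply: eq_card => S; rewrite !inE andbC.
have FnE : #|Fn| = #|[set S in Fn | v \in S]| + #|[set S in Fn | v \notin S]|.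
  rewrite -(cardsID [set S : {set V} | v \in S] Fn); congr (_ + _).
    by apply: eq_card => S; rewrite !inE.
  by apply: eq_card => S; rewrite !inE andbC.
have set2_inj x y z : [set x; y] = [set x; z] -> y = z :> V.
  by move=> /eq_set2[[]|[-> ->]].
have h1 : 1 <= #|[set S in Fu | v \in S]|.
  apply/card_gt0P; exists [set u; v]; rewrite !inE !eqxx orbT andbT.
  by rewrite adjF // /adj /= uvE.
have h2 : #|nbrs u v| <= #|[set S in Fu | v \notin S]|.
  rewrite -(@card_imset _ _ (fun p => [set u; p])) => [|x y /set2_inj//].
  apply: subset_leq_card; apply/subsetP => _ /imsetP[p + ->].
  rewrite !inE => /andP[up pv]; rewrite adjF // eqxx /= negb_or.
  by rewrite eq_sym uv eq_sym.
have h3 : #|nbrs v u| <= #|[set S in Fn | v \in S]|.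
  rewrite -(@card_imset _ _ (fun p => [set v; p])) => [|x y /set2_inj//].
  apply: subset_leq_card; apply/subsetP => _ /imsetP[p + ->].
  rewrite !inE => /andP[up pv]; rewrite adjF // eqxx /= negb_or.
  by rewrite uv eq_sym pv.
suff : #|squares| <= #|[set S in Fn | v \notin S]| by lia.
rewrite -(@card_in_imset _ _ (fun pq : V * V => [set pq.1; pq.2]) squares).
  apply: subset_leq_card; apply/subsetP => _ /imsetP[[p q] + ->].
  rewrite !inE /= => /and5P[up pv vq qu pq]; rewrite adjF // !negb_or /=.
  rewrite (adj_neq up) (adj_neq vq) eq_sym qu eq_sym pv.
  by [].
move=> [p q] [p' q']; rewrite !inE /= => /and5P[up _ _ _ _] /and5P[_ _ vq' _ _].
(* In the swapped case [p] is adjacent to both [u] and [v], which makes a triangle. *)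
move=> /eq_set2[[-> ->]//|[pq' _]]; case: (@E_tf v u p); split=> //.
  by rewrite /adj /= uvE orbT.
by rewrite pq'.
Qed.

End EdgeDegrees.

(** Among the 3-sets of edges containing [e], those outside [NBC E] are broken 4-cycles containing
    [e], and each is determined by a square. *)
Lemma card_NBC3_ge (e : V * V) : e \in E ->
  'C(#|E|.-1, 2) <= #|[set A in NBC E | (e \in A) && (#|A| == 3)]| + #|squares e.1 e.2|.
Proof.
move=> eE; pose T := [set A : {set V * V} | [&& A \subset E, e \in A & #|A| == 3]].
have T_card : #|T| = 'C(#|E|.-1, 2).
  rewrite (_ : #|E|.-1 = #|E :\ e|); last by rewrite (cardsD1 e E) eE.
  rewrite -cards_draws.
  rewrite -(@card_in_imset _ _ (fun A : {set V * V} => A :\ e) T).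
    apply: eq_card => B; rewrite inE; apply/imsetP/andP => [[A]|[sB /eqP B2]].
      rewrite inE => /and3P[sAE eA /eqP A3] ->; split; first exact: setSD.
      by move: A3; rewrite (cardsD1 e) eA add1n => -[->].
    have eB : e \notin B by apply/negP => /(subsetP sB); rewrite !inE eqxx.
    exists (e |: B); last by rewrite setU1K.
    rewrite inE setU11 subUset sub1set eE cardsU1 eB B2 andbT /=.
    exact: subset_trans sB (subD1set _ _).
  move=> A B; rewrite !inE => /and3P[_ eA _] /and3P[_ eB _] AB.
  by rewrite -(setD1K eA) AB setD1K.
rewrite -T_card -(cardsID (NBC E) T); apply: leq_add.
  apply: subset_leq_card; apply/subsetP => A.
  by rewrite !inE => /andP[/and3P[_ -> ->] ->].
pose psi (pq : V * V) := nonmin (cycle4 e.1 e.2 pq.2 pq.1).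
apply: leq_trans (leq_imset_card psi _).
apply: subset_leq_card; apply/subsetP => A; rewrite !inE.
move=> /andP[An /and3P[sAE eA /eqP A3]]; rewrite sAE /= in An.
have eE' : (e.1, e.2) = e by case: (e).
rewrite -eE' in eA.
have [pq pqS ->] := broken4_square eA (broken4P sAE A3 An).
exact: imset_f.
Qed.

Lemma card_NBC3_ge_sqrt (R : rcfType) (e : V * V) : 4 <= #|E| -> e \in E ->
  ('C(#|E| - 2, 2)%:R + 2 * Num.sqrt #|E|%:R - 3
    <= #|[set A in NBC E | (e \in A) && (#|A| == 3)]|%:R :> R)%R.
Proof.
move=> m4 eE; have eE' : (e.1, e.2) \in E by case: (e) eE.
have := card_NBC3_ge eE; have := card_squares_nbrs_le eE'.
have := card_squares_le e.1 e.2.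
move: #|nbrs e.1 e.2| => a; move: #|nbrs e.2 e.1| => b.
move: #|squares e.1 e.2| => x; move: #|[set A in NBC E | _]| => q.
(* From here [m] stands for [#|E| - 2], and Pascal's rule splits ['C(m.+1, 2)] into
   ['C(m, 2) + m]. *)
move: m4; case: #|E| => [|[|m]] // m2 xab abm; rewrite binS bin1 !subSS subn0 /= => qx.
have := sqr_sqrtr (ler0n R m.+2); have := sqrtr_ge0 (m.+2%:R : R).
move: (Num.sqrt _) => s s0 s2.
have s1 : (1 <= s)%R.
  rewrite leNgt; apply/negP => s1; have : (m.+2%:R < 1 :> R)%R by rewrite -s2 expr_lt1.
  by rewrite ltrn1.
have xab' : (x%:R <= a%:R * b%:R :> R)%R by rewrite -natrM ler_nat.
have abm' : (1 + a%:R + b%:R + x%:R <= s ^+ 2 :> R)%R.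
  by rewrite s2 -[1%R]/(1%:R)%R -!natrD ler_nat.
have qx' : ('C(m, 2)%:R + (s ^+ 2 - 2) <= q%:R + x%:R :> R)%R.
  have -> : (s ^+ 2 - 2 = m%:R)%R by rewrite s2 -addn2 natrD addrK.
  by rewrite -!natrD ler_nat; lia.
suff : (x%:R <= (s - 1) ^+ 2)%R by nra.
(* Otherwise [a + b < 2 * (s - 1)], so the inequality of the means gives
   [x <= a * b <= (s - 1) ^ 2], a contradiction. *)
rewrite leNgt; apply/negP => xs.
have ab : (a%:R + b%:R < 2 * (s - 1) :> R)%R by nra.
have ab2 : ((a%:R + b%:R) ^+ 2 <= (2 * (s - 1)) ^+ 2 :> R)%R.
  by rewrite ler_sqr ?nnegrE ?addr_ge0 //; lra.
have := sqr_ge0 (a%:R - b%:R : R)%R; rewrite sqrrB; rewrite sqrrD in ab2; nra.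
Qed.

End TriangleFree.

Lemma proper_coloring_edges (V : finType) (e : rel V) (C : eqType) (f : V -> C) :
  symmetric e -> irreflexive e ->
  proper_coloring e f = [forall a in edges e, f a.1 != f a.2].
Proof.
move=> e_sym e_irr; apply/forallP/forall_inP => [H [x y]|H x].
  by rewrite inE => /andP[xy _]; exact: (implyP (forallP (H x) y)).
apply/forallP => y; apply/implyP => xy.
case: (ltngtP (enum_rank x) (enum_rank y)) => [xy'|yx|/val_inj/enum_rank_inj xyE].
- by apply: (H (x, y)); rewrite inE xy.
- by rewrite eq_sym; apply: (H (y, x)); rewrite inE /= e_sym xy.
- by rewrite xyE e_irr in xy.
Qed.

(** * The coefficient of a single edge *)

Section EdgeBound.

Variables (R : realFieldType) (V : finType) (E : {set V * V}).
Hypothesis E_irr : forall h, h \in E -> h.1 != h.2.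
Hypothesis E_asym : forall x y, (x, y) \in E -> (y, x) \notin E.
Variables (m : nat) (e : V * V).
Hypothesis card_E : #|E| = m.
Hypothesis eE : e \in E.
Implicit Types (A B : {set V * V}).
Local Open Scope ring_scope.

Lemma set1_NBC : [set e] \in NBC E.
Proof.
rewrite inE sub1set eE; apply/forall_inP => h hE; apply/negP => hc.
have h12 := E_irr hE.
have [h12'|/(ends_inj E_asym hE eE) he] := con_set1 (con_sub (above_sub _ _) hc).
  by rewrite h12' eqxx in h12.
case/eqP: h12; apply: (@con_const _ _ id _ _ _ _ hc) => a.
by rewrite in_above inE he => /andP[/eqP->]; rewrite ltnn.
Qed.

Lemma card_extensions_le B : B \in NBC E -> (#|extensions E B| + #|B| <= m)%N.
Proof.
rewrite inE => /andP[sBE _]; rewrite -card_E -(cardsID B E) (setIidPr sBE) addnC leq_add2l.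
by apply: subset_leq_card; apply/subsetP => g; rewrite inE => /andP[].
Qed.

(** Double counting is used twice: extensions of [[set e]] count the 2-sets containing [e], and
    extensions of these count each 3-set twice, with at least [(m - 3) / 4] for each 2-set. *)
Lemma card_NBC3_ge_extensions :
  #|extensions E [set e]|%:R * (m%:R - 3) <=
  8 * #|[set A in NBC E | (e \in A) && (#|A| == 3%N)]|%:R :> R.
Proof.
pose phi (j i : nat) : R := (i == j)%:R.
have := sum_extensions E (phi 2) e.
rewrite [RHS](bigD1 [set e]) /=; last by rewrite set1_NBC set11.
rewrite /phi cards1 eqxx [X in _ = _ + X]big1 ?addr0 => [E2|B /andP[/andP[_ eB] Be]]; last first.
  rewrite eqSS; case: eqP => [/eqP/cards1P[x Bx]|]; last by rewrite mul0rn.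
  by move: Be eB; rewrite Bx inE => /eqP xe /eqP ex; case: xe; rewrite ex.
have E3 := sum_extensions E (phi 3) e.
have q3E : \sum_(A in NBC E | e \in A) phi 3%N #|A| *+ #|A|.-1 =
    2 * #|[set A in NBC E | (e \in A) && (#|A| == 3%N)]|%:R.
  rewrite -sum1_card natr_sum mulr_sumr [RHS](eq_bigl (fun A : {set V * V} =>
    ((A \in NBC E) && (e \in A)) && (#|A| == 3%N))); last first.
    by move=> A; rewrite !inE andbA.
  rewrite [RHS]big_mkcondr; apply: eq_bigr => A _; rewrite /phi.
  by case: eqP => [->|_]; rewrite ?mul0rn // mulr1.
rewrite q3E in E3.
have -> : 8 = 4 * 2 :> R by ring.
rewrite -mulrA E3.
rewrite -E2 mulr_suml mulr_sumr; apply: ler_sum => B /andP[B_nbc eB].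
rewrite /phi eqSS; case: eqP => [B2|_]; last by rewrite !mul0rn mul0r mulr0.
have := card_extensions2_ge E_irr E_asym B_nbc B2.
rewrite card_E B2 -(ler_nat R) natrD natrM /= !mulr1n mul1r; lra.
Qed.

Variable k : nat.
Hypotheses (k_gt0 : (0 < k)%N) (k_ge : (m - 1 <= k)%N).

Local Notation weight := (weight R #|V| k).

(** Only the sets of size 1 and 3 are kept. Every other term is nonnegative, because an odd set [B]
    has at most [m - #|B| <= k] extensions. *)
Lemma edge_coeff_ge :
  weight 2 * (k%:R - #|extensions E [set e]|%:R) +
  weight 4 / 3 * (k%:R - m%:R + 3) *
    #|[set A in NBC E | (e \in A) && (#|A| == 3%N)]|%:R
  <= \sum_(B in NBC E | (e \in B) && odd #|B|)
      weight #|B|.+1 / #|B|%:R * (k%:R - #|extensions E B|%:R).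
Proof.
rewrite [leRHS](bigD1 [set e]) /=; last by rewrite set1_NBC set11 cards1.
rewrite cards1 divr1 lerD2l.
have w0 i : 0 <= weight i by rewrite ltW ?weight_gt0.
rewrite -[#|[set A in NBC E | _]|]sum1_card natr_sum mulr_sumr [leLHS]big_mkcond [leRHS]big_mkcond /=.
apply: ler_sum => B _; rewrite inE; case B_nbc: (B \in NBC E) => //=.
have := card_extensions_le B_nbc.
case eB: (e \in B) => //=; case: eqP => [B3|_].
  rewrite B3 /=; have -> : B != [set e] by apply/eqP => Be; rewrite Be cards1 in B3.
  rewrite mulr1 => ext_le; apply: ler_wpM2l; first by rewrite divr_ge0.
  move: ext_le; rewrite -(ler_nat R) natrD; lra.
case: ifP => // /andP[Bodd Be] ext_le; apply: mulr_ge0; first by rewrite divr_ge0 ?ler0n.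
rewrite subr_ge0 ler_nat; move: Bodd ext_le; lia.
Qed.

Lemma edge_bound (c : R) : (3 <= m)%N ->
  (c <= #|[set A in NBC E | (e \in A) && (#|A| == 3%N)]|%:R \/
   c = (m%:R - 1) * (m%:R - 3) / 8) ->
  (k%:R - m%:R + 1) * weight 2 + (k%:R - m%:R + 3) * c / 3 * weight 4
  <= \sum_(B in NBC E | (e \in B) && odd #|B|)
      weight #|B|.+1 / #|B|%:R * (k%:R - #|extensions E B|%:R).
Proof.
move=> m3 cP; apply: le_trans edge_coeff_ge.
have -> : weight 2 = k%:R ^+ 2 * weight 4 by rewrite weightS // weightS // mulrA expr2.
have := card_NBC3_ge_extensions; have := card_extensions_le set1_NBC.
rewrite cards1 -(ler_nat R) natrD.
have := weight_gt0 R V k_gt0 4; move: (weight 4) => w w0.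
move: #|extensions _ _| => x; move: #|[set A in NBC E | _]| cP => q cP xm qx.
have mk : m%:R <= k%:R + 1 :> R by rewrite natr1 ler_nat; lia.
move: m3; rewrite -(ler_nat R); move: m%:R cP xm qx mk => m0 cP xm qx mk m3.
rewrite [_ * w in leLHS]mulrC -subr_ge0.
set d := _ - _.
have -> : d = w * (k%:R ^+ 2 * (m0 - 1 - x%:R) + (k%:R - m0 + 3) / 3 * (q%:R - c)).
  by rewrite /d; ring.
apply: mulr_ge0; first exact: ltW.
case: cP => [cq|->].
  by rewrite addr_ge0 // mulr_ge0 ?exprn_ge0 ?divr_ge0 ?ler0n //; lra.
(* [t] counts the edges other than [e] that do not extend [[set e]]; the gain [k ^ 2 * t] must
   outweigh the loss in [q]. *)
set t := m0 - 1 - x%:R; have t0 : 0 <= t by rewrite /t; lra.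
have qt : - (t * (m0 - 3) / 8) <= q%:R - (m0 - 1) * (m0 - 3) / 8 by rewrite /t; lra.
have h0 : 0 <= (k%:R - m0 + 3) / 3 by lra.
apply: le_trans (_ : k%:R ^+ 2 * t + (k%:R - m0 + 3) / 3 * - (t * (m0 - 3) / 8) <= _);
  last by rewrite lerD2l ler_wpM2l.
have -> : k%:R ^+ 2 * t + (k%:R - m0 + 3) / 3 * - (t * (m0 - 3) / 8)
  = t * (k%:R ^+ 2 - (k%:R - (m0 - 3)) * (m0 - 3) / 24) by field.
(* For [y = m0 - 3], the product [(k - y) * y] is at most a quarter of [k ^ 2]. *)
apply: mulr_ge0 => //; nra.
Qed.

End EdgeBound.

(** Both counts are expanded by [whitney], the ordinary colorings being list colorings from the full
    lists [T], for which every component has exactly [k] common colors. *)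
Lemma sum_edge_bounds (R : realFieldType) (V U : finType) (E : {set V * V})
    (L : V -> {set U}) (k : nat) (c0 : U) (b : R) :
  (forall h, h \in E -> h.1 != h.2) -> (forall v, #|L v| = k) -> 0 < k ->
  (forall e, e \in E ->
    b <= \sum_(B in NBC E | (e \in B) && odd #|B|)
      weight R #|V| k #|B|.+1 / #|B|%:R * (k%:R - #|extensions E B|%:R))%R ->
  (b * (\sum_(e in E) alpha L e)%:R <=
    #|[set f in list_maps L | [forall a in E, f a.1 != f a.2]]|%:R -
    #|[set f : {ffun V -> 'I_k} | [forall a in E, f a.1 != f a.2]]|%:R)%R.
Proof.
move=> E_irr L_k k_gt0 bP; pose T (v : V) := [set: 'I_k].
have T_all : [set f : {ffun V -> 'I_k} | [forall a in E, f a.1 != f a.2]]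
    = [set f in list_maps T | [forall a in E, f a.1 != f a.2]].
  by apply/setP => f; rewrite !inE; rewrite [X in _ = X && _](_ : _ = true) //;
    apply/forallP => v; rewrite inE.
have monoT A : A \in NBC E -> (#|mono_maps T A|%:R = k%:R * weight R #|V| k #|A|)%R.
  move=> A_nbc; rewrite (card_mono_maps T (Ordinal k_gt0)) -(expr_roots R k_gt0 A_nbc).
  rewrite (eq_bigr (fun=> k)) ?prod_nat_const ?natrX // => r _.
  rewrite -[RHS]card_ord -cardsT; congr #|pred_of_set _|.
  apply/setP => c; rewrite in_setT in_set; apply/forallP => y.
  by rewrite in_setT implybT.
rewrite T_all !(whitney E_irr) -sumrB natr_sum mulr_sumr.
rewrite (eq_bigr (fun A : {set V * V} => (-1) ^+ #|A| * (#|mono_maps L A|%:R -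
  k%:R * weight R #|V| k #|A|)))%R; last by move=> A /monoT->; rewrite mulrBr.
apply: le_trans (sum_signed_defects_ge R E L_k k_gt0 c0).
by apply: ler_sum => e eE; rewrite mulrC; apply: ler_wpM2l; rewrite ?ler0n ?bP.
Qed.

(** * Passage from lists of integers to finite types, and the theorem *)

Lemma card_fset_sub (T : choiceType) (A S : {fset T}) : (S `<=` A)%fset ->
  #|[set c : A | fsval c \in S]| = #|` S|.
Proof.
move=> /fsubsetP sSA; transitivity (count [in S] (enum_fset A)).
  rewrite cardE /enum_mem size_filter -enumT enum_fsetE count_map.
  by apply: eq_count => c; rewrite /= inE.
rewrite -size_filter; apply: perm_size.
apply: uniq_perm; rewrite ?filter_uniq ?fset_uniq //.
by move=> x; rewrite mem_filter andb_idr //; apply: sSA.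
Qed.

Local Open Scope ring_scope.

Theorem theorem1 (R : realType) (V : finType) (e : rel V)
    (e_sym : symmetric e) (e_irr : irreflexive e)
    (n m : nat) (card_V : #|V| = n) (card_E : #|edges e| = m)
    (m_ge4 : (4 <= m)%N)
    (k : nat) (k_gt0 : (0 < k)%N) (k_ge : (m - 1 <= k)%N)
    (L : V -> {fset nat}) (L_k : is_assignment k L) :
  let bound_holds (c : R) :=
    (num_list_colorings e L)%:R - (num_colorings e k)%:R >=
      ((k%:R - m%:R + 1) * k%:R ^ (n%:Z - 3)
       + (k%:R - m%:R + 3) * c / 3 * k%:R ^ (n%:Z - 5))
      * (sum_list_diff e L)%:R in
  (exists c : R, c >= (m%:R - 1) * (m%:R - 3) / 8 /\ bound_holds c)
  /\ (triangle_free e ->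
      exists c : R, c >= 'C(m - 2, 2)%:R + 2 * Num.sqrt m%:R - 3
                    /\ bound_holds c).
Proof.
move=> bound_holds; pose E := edges e.
have E_irr h : h \in E -> h.1 != h.2.
  by rewrite inE => /andP[he _]; apply: contraTneq he => ->; rewrite e_irr.
have E_asym x y : (x, y) \in E -> (y, x) \notin E.
  by rewrite !inE /= => /andP[_ xy]; rewrite negb_and -leqNgt (ltnW xy) orbT.
have adjE x y : adj E x y -> e x y.
  by rewrite /adj /= !inE /= => /orP[] /andP[]; rewrite // e_sym.
pose A := (\bigcup_(v <- enum V) L v)%fset; pose Ls v : {set A} := [set c | fsval c \in L v].
have LA v : (L v `<=` A)%fset by apply: bigfcup_sup; rewrite ?mem_enum.
have Ls_k v : #|Ls v| = k by rewrite card_fset_sub //; have [] := L_k v.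
have /card_gt0P[[v0 _] _] : (0 < #|E|)%N by rewrite card_E; apply: leq_trans m_ge4.
have [c0 _] : exists c, c \in Ls v0 by apply/card_gt0P; rewrite Ls_k.
have alphaE a : alpha Ls a = #|` L a.1 `\` L a.2|%fset.
  rewrite -(@card_fset_sub _ A) ?(fsubset_trans (fsubsetDl _ _)) //.
  by apply: eq_card => c; rewrite !inE.
have bound c : (forall a, a \in E ->
    c <= #|[set B in NBC E | (a \in B) && (#|B| == 3%N)]|%:R \/
    c = (m%:R - 1) * (m%:R - 3) / 8) -> bound_holds c.
  move=> cP; have := sum_edge_bounds c0 E_irr Ls_k k_gt0
    (fun a aE => edge_bound E_irr E_asym card_E aE k_gt0 k_ge (ltnW m_ge4) (cP a aE)).
  rewrite /bound_holds /sum_list_diff /num_list_colorings /num_colorings.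
  rewrite (eq_bigr _ (fun a _ => alphaE a)) /weight card_V.
  rewrite (_ : n%:Z - 2%:Z - 1 = n%:Z - 3); last by lia.
  rewrite (_ : n%:Z - 4%:Z - 1 = n%:Z - 5); last by lia.
  congr (_ <= _%:R - _%:R); apply: eq_card => f; rewrite !inE.
    rewrite /list_coloring (proper_coloring_edges _ e_sym e_irr); congr (_ && _).
    by apply: eq_forallb => v; rewrite inE.
  by rewrite (proper_coloring_edges _ e_sym e_irr).
split; first by exists ((m%:R - 1) * (m%:R - 3) / 8); split=> //;
  apply: bound => a _; right.
move=> e_tf; exists ('C(m - 2, 2)%:R + 2 * Num.sqrt m%:R - 3); split=> //.
apply: bound => a aE; left; rewrite -card_E.
apply: card_NBC3_ge_sqrt; rewrite ?card_E // => x y z [xy yz xz].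
by apply: (e_tf x y z); split; apply: adjE.
Qed.
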